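(* Let $T$ be a tree with $n=n(T)\geq 3$ vertices and ${\rm diam}(T)\leq\frac{1+\sqrt{4n-3}}{2}$. Then $E_2(T)\leq W(T)$, with equality if and only if $T\cong P_3$.
   Context: $\varepsilon_T(v)=\max_u d_T(v,u)$ is the eccentricity, ${\rm diam}(T)=\max_v\varepsilon_T(v)$, $E_2(T)=\sum_{uv\in E(T)}\varepsilon_T(u)\varepsilon_T(v)$, $W(T)=\sum_{\{u,v\}\subseteq V(T)}d_T(u,v)$ is the Wiener index, and $P_3$ is the path on $3$ vertices. *)

(* Defs.v *)
From mathcomp Require Import all_boot.

Set Implicit Arguments.
Unset Strict Implicit.
Unset Printing Implicit Defensive.

Section Graphs.

(* A finite simple graph is a symmetric irreflexive adjacency relation [e]. *)
Variables (V : finType) (e : rel V).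

Definition simple_graph : Prop := symmetric e /\ irreflexive e.

Definition connected_graph : Prop := forall u v : V, connect e u v.

(* Cycles of size 1 are loops, and a single edge is a [cycle] of size 2, so
   graph-theoretic cycles are the duplicate-free ones of size at least 3. *)
Definition acyclic_graph : Prop :=
  forall c : seq V, 2 < size c -> ~~ ucycleb e c.

Definition is_tree : Prop :=
  [/\ simple_graph, connected_graph & acyclic_graph].

Definition walk_of_length (k : nat) (u v : V) : bool :=
  [exists p : k.-tuple V, path e u p && (last u p == v)].

(* The least k with a walk of length k from u to v. If v is reachable from u,
   then this k is less than #|V|; otherwise the value is #|V|. *)
Definition gdist (u v : V) : nat :=
  find (fun k => walk_of_length k u v) (iota 0 #|V|).

Definition ecc (v : V) : nat := \max_(u : V) gdist v u.

Definition diam : nat := \max_(v : V) ecc v.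

(* Comparing ranks in the enumeration of V makes each unordered pair {u, v}
   of distinct vertices count exactly once. *)
Definition E2 : nat :=
  \sum_(u : V) \sum_(v : V | (enum_rank u < enum_rank v) && e u v)
    ecc u * ecc v.

Definition wiener : nat :=
  \sum_(u : V) \sum_(v : V | enum_rank u < enum_rank v) gdist u v.

End Graphs.

Definition graph_iso (V W : finType) (e : rel V) (e' : rel W) : Prop :=
  exists2 f : V -> W, bijective f & forall u v : V, e u v = e' (f u) (f v).

Definition path_graph (n : nat) : rel 'I_n :=
  fun i j => (i.+1 == j :> nat) || (j.+1 == i :> nat).
Arguments path_graph n : clear implicits.

(* Main.v *)
(** Let [D] be the diameter and [m] the number of edges. The eccentricities of
    adjacent vertices cannot both equal [D] when [2 <= D], so that
    [E2 <= m * (D * (D - 1))]; the hypothesis on the diameter says exactly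
    [D * (D - 1) <= n - 1]. Nonadjacent vertices are at distance at least 2,
    so that [W >= n * (n - 1) - m]. As [m <= n - 1], both bounds meet at
    [(n - 1) ^ 2], and equality forces [D <= 2] and [n = D * (D - 1) + 1].

    Everything about trees follows from one fact: for any root [r], a vertex
    [v] has at most one neighbour [a] with [d(r, a) <= d(r, v)]. *)

Require Import Defs.
From mathcomp Require Import all_boot all_order all_algebra.
From mathcomp Require Import zify lra.
Import Order.TTheory GRing.Theory Num.Theory.

(** * Sums over unordered pairs of vertices *)

Section UnorderedPairs.

Set Implicit Arguments.
Unset Strict Implicit.

Variable V : finType.

Lemma sum_pairs_sym (F : V -> V -> nat) :
  \sum_(u : V) \sum_(v : V | enum_rank u < enum_rank v) (F u v + F v u) =
  \sum_(u : V) \sum_(v : V | v != u) F u v.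
Proof.
under eq_bigr do rewrite big_split /=.
rewrite big_split /=.
rewrite [X in _ + X](exchange_big_dep predT) //= -big_split /=.
apply: eq_bigr => u _; rewrite [RHS](bigID (fun v => enum_rank u < enum_rank v)) /=.
have neq_rank v : (v != u) = (enum_rank v != enum_rank u :> nat).
  by rewrite -(inj_eq enum_rank_inj).
by congr (_ + _); apply: eq_bigl => v; rewrite neq_rank; case: ltngtP.
Qed.

Lemma sum_pairs_const :
  \sum_(u : V) \sum_(v : V | enum_rank u < enum_rank v) 2 = #|V| * #|V|.-1.
Proof.
rewrite (sum_pairs_sym (fun _ _ => 1)).
under eq_bigr => u _ do rewrite sum1_card cardC1.
by rewrite sum_nat_const.
Qed.

Lemma rank_lt_neq (u v : V) : enum_rank u < enum_rank v -> u != v.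
Proof. by apply: contraTneq => ->; rewrite ltnn. Qed.

(** Serves the equality case: once the totals agree, a termwise bound has no slack left in any
    single term. *)
Lemma eq_sum_pairs_leq (F G : V -> V -> nat) :
  (forall u v, u != v -> F u v <= G u v) ->
  \sum_(u : V) \sum_(v : V | enum_rank u < enum_rank v) G u v <=
    \sum_(u : V) \sum_(v : V | enum_rank u < enum_rank v) F u v ->
  forall u v, enum_rank u < enum_rank v -> F u v = G u v.
Proof.
move=> leFG; rewrite !pair_big_dep /= => leGF u v ltuv.
have leFGp (p : V * V) : enum_rank p.1 < enum_rank p.2 ->
    F p.1 p.2 <= G p.1 p.2 ?= iff (F p.1 p.2 == G p.1 p.2).
  by move=> ltp; split=> //; apply/leFG/rank_lt_neq.
have [le_sum eq_sum] := leqif_sum leFGp.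
have : \sum_(p : V * V | enum_rank p.1 < enum_rank p.2) F p.1 p.2 ==
       \sum_(p : V * V | enum_rank p.1 < enum_rank p.2) G p.1 p.2.
  by rewrite eqn_leq le_sum leGF.
by rewrite eq_sum => /forall_inP /(_ (u, v)) /= /(_ ltuv) /eqP.
Qed.

End UnorderedPairs.

(** * Distances and geodesics in a connected graph *)

Section Distance.

Set Implicit Arguments.
Unset Strict Implicit.

Variables (V : finType) (e : rel V).

Lemma walkP {k u v} :
  reflect (exists p, [/\ path e u p, last u p = v & size p = k])
          (walk_of_length e k u v).
Proof.
apply: (iffP existsP) => [[p /andP[pp /eqP lp]]|[p [pp lp sp]]].
  by exists p; rewrite size_tuple.
by move/eqP: sp => sp; exists (Tuple sp); rewrite /= pp lp eqxx.
Qed.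

Lemma gdist_le u p : path e u p -> gdist e u (last u p) <= size p.
Proof.
(* [find] never exceeds the length of the searched list, which settles walks of length at least
   [#|V|]. *)
move=> pp; have lepV : gdist e u (last u p) <= #|V|.
  by rewrite -[X in _ <= X](size_iota 0) find_size.
case: (ltnP (size p) #|V|) => [ltp|/(leq_trans lepV)//].
rewrite leqNgt; apply/negP => /(before_find 0).
by rewrite nth_iota // add0n => /walkP[]; exists p.
Qed.

Lemma gdistxx u : gdist e u u = 0.
Proof. by apply/eqP; rewrite -leqn0; apply: (@gdist_le u [::]). Qed.

Lemma gdist_edge u v : e u v -> gdist e u v <= 1.
Proof. by move=> uv; apply: (@gdist_le u [:: v]); rewrite /= uv. Qed.

Lemma gdist_le_ecc u v : gdist e u v <= ecc e u.
Proof. exact: (leq_bigmax_cond (P := xpredT)). Qed.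

Lemma ecc_le_diam u : ecc e u <= diam e.
Proof. exact: (leq_bigmax_cond (P := xpredT)). Qed.

Lemma ecc_attained u : exists v, gdist e u v = ecc e u.
Proof.
rewrite /ecc; have [|v ->] := @bigop.eq_bigmax V (gdist e u); last by exists v.
by apply/card_gt0P; exists u.
Qed.

Hypothesis conn : connected_graph e.

(** A duplicate-free path from [u] to [v] has fewer than [#|V|] edges, so the search defining
    [gdist] succeeds within its range. *)
Lemma geodesic u v :
  exists p, [/\ path e u p, last u p = v & size p = gdist e u v].
Proof.
apply/walkP.
have hasw : has (fun k => walk_of_length e k u v) (iota 0 #|V|).
  have /connectP[q pq ->] := conn u v.
  have [p pp up _] := shortenP pq.
  apply/hasP; exists (size p); last by apply/walkP; exists p.
  by rewrite mem_iota /= add0n -[(size p).+1]/(size (u :: p)) -(card_uniqP up) max_card.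
have ltd : gdist e u v < #|V| by rewrite -[X in _ < X](size_iota 0) -has_find.
by have := nth_find 0 hasw; rewrite nth_iota.
Qed.

Lemma gdist_eq0 u v : gdist e u v = 0 -> u = v.
Proof. by have [p [_ <- <-]] := geodesic u v; case: p. Qed.

Lemma gdist_le1 u v : gdist e u v <= 1 -> u != v -> e u v.
Proof.
have [[|w [|w' p]] [pp <- <-]] := geodesic u v; rewrite ?eqxx //= => _ _.
by case/andP: pp.
Qed.

Lemma gdist_step r u v : e u v -> gdist e r v <= (gdist e r u).+1.
Proof.
move=> uv; have [p [pp lp <-]] := geodesic r u.
have := @gdist_le r (rcons p v).
by rewrite rcons_path pp lp uv last_rcons size_rcons; apply.
Qed.

Hypothesis e_sym : symmetric e.

Lemma gdist_sym u v : gdist e u v = gdist e v u.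
Proof.
have le w z : gdist e w z <= gdist e z w.
  have [p [pp lp <-]] := geodesic z w.
  (* The geodesic read backwards; its starting vertex [w = last z p] is left out. *)
  have := @gdist_le w (rev (belast z p)).
  rewrite -lp rev_path (eq_path (e' := e)); last by move=> x y; rewrite e_sym.
  rewrite size_rev size_belast => /(_ pp).
  by case: p {pp lp} => //= y p; rewrite rev_cons last_rcons.
by apply/eqP; rewrite eqn_leq !le.
Qed.

Lemma gdist_parent r v k :
  gdist e r v = k.+1 -> exists2 w, e v w & gdist e r w = k.
Proof.
move=> dv; have [p [pp lp sp]] := geodesic r v.
case/lastP: p => [|p w] in pp lp sp; first by rewrite dv in sp.
move: pp lp sp; rewrite rcons_path last_rcons size_rcons dv => /andP[pp lw] wv [sp].
rewrite -wv; exists (last r p); first by rewrite e_sym.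
have := gdist_le pp; have := gdist_step r lw.
by rewrite wv dv sp; lia.
Qed.

End Distance.

(** * Parents, eccentricities along an edge, and the number of edges in a tree *)

Section Tree.

Set Implicit Arguments.
Unset Strict Implicit.

Variables (V : finType) (e : rel V).
Hypothesis tree : is_tree e.

Let e_sym : symmetric e. Proof. by case: tree => [[]]. Qed.
Let e_irr : irreflexive e. Proof. by case: tree => [[]]. Qed.
Let conn : connected_graph e. Proof. by case: tree. Qed.
Let acyc : acyclic_graph e. Proof. by case: tree. Qed.

Lemma adjacent_neq u v : e u v -> u != v.
Proof. by apply: contraTneq => ->; rewrite e_irr. Qed.

(** Adjacency in the graph with the vertex [v] deleted. *)
Definition avoiding (v : V) : rel V :=
  [rel y z | [&& e y z, y != v & z != v]].

Lemma avoiding_connect_sym v : connect_sym (avoiding v).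
Proof.
apply: sym_connect_sym => y z.
by rewrite /avoiding /= e_sym [(z != v) && _]andbC.
Qed.

(** Otherwise a path from [a] to [b] off [v] closes up through [v] to a cycle, of length at least 3
    because the path is not empty. *)
Lemma neighbours_separated v a b :
  e v a -> e v b -> connect (avoiding v) a b -> a = b.
Proof.
move=> va vb /connectP[q pq lb]; move: lb.
have [p pp up _] := shortenP pq => lb.
case: p => [|c p] in pp up lb *; first by [].
exfalso; have /negP := acyc (c := [:: v, a, c & p]) isT; apply.
have sub : subrel (avoiding v) e by move=> y z /and3P[].
have nav := adjacent_neq va.
have vnotin (x : V) s : path (avoiding v) x s -> v \notin s.
  elim: s x => //= y s IH x /andP[/and3P[_ _ yv] /IH].
  by rewrite inE negb_or eq_sym yv.
rewrite /ucycleb [uniq _]cons_uniq up andbT inE negb_or nav (vnotin _ _ pp) andbT.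
have -> : cycle e [:: v, a, c & p] = e v a && path e a (rcons (c :: p) v).
  by [].
by rewrite va rcons_path (sub_path sub pp) -lb e_sym vb.
Qed.

(** Going down from [a] to [r] by parents, every later vertex is strictly closer to [r] than [a],
    hence than [v], so [v] is never met. *)
Lemma connect_avoiding r v a :
  a != v -> gdist e r a <= gdist e r v -> connect (avoiding v) r a.
Proof.
elim: {a}(gdist e r a) {-2}a (erefl (gdist e r a)) => [|k IH] a.
  by move=> /(gdist_eq0 conn) <-.
move=> da av; rewrite da => lek.
have [w aw dw] := gdist_parent conn e_sym da.
have wv : w != v by apply: contraTneq lek => <-; rewrite dw ltnn.
apply: connect_trans (IH w dw wv _) (connect1 _); first by rewrite dw ltnW.
by rewrite /avoiding /= e_sym aw wv av.
Qed.

Lemma parent_unique r v a b :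
  e v a -> e v b -> gdist e r a <= gdist e r v -> gdist e r b <= gdist e r v ->
  a = b.
Proof.
move=> va vb da db; apply: (neighbours_separated va vb).
apply: (@connect_trans _ _ r); last by apply: connect_avoiding => //; rewrite eq_sym adjacent_neq.
by rewrite avoiding_connect_sym; apply: connect_avoiding => //; rewrite eq_sym adjacent_neq.
Qed.

(** With equal distances, [v] would have to be the unique parent of [u], which is one step closer to
    [r]. *)
Lemma gdist_edge_neq r u v : e u v -> gdist e r u <> gdist e r v.
Proof.
move=> uv duv; case du: (gdist e r u) => [|k].
  have ru := gdist_eq0 conn du; have rv := gdist_eq0 conn (etrans (esym duv) du).
  by rewrite -ru -rv e_irr in uv.
have [w uw dw] := gdist_parent conn e_sym du.
have wv : w = v by apply: (parent_unique (r := r) uw uv); lia.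
by move: dw; rewrite wv; lia.
Qed.

(* The geodesic from [u] to [y] never turns back towards [x]. *)
Lemma gdist_across x y u v :
  e u v -> gdist e x v < gdist e x u -> gdist e y u < gdist e y v ->
  gdist e x u + gdist e y u <= gdist e x y.
Proof.
elim: {u}(gdist e y u) {-2}u (erefl (gdist e y u)) v => [|k IH] u du v uv dx dy.
  by rewrite -(gdist_eq0 conn du) gdistxx addn0.
have [w uw dw] := gdist_parent conn e_sym du.
have wv : w <> v by move=> wv; move: dy; rewrite -wv; lia.
(* Otherwise [v] and [w] would be two distinct neighbours of [u] no farther from [x] than [u]. *)
have dxw : gdist e x u < gdist e x w.
  rewrite ltnNge; apply/negP => le; apply: wv.
  by apply: (parent_unique (r := x) uw uv le); apply: ltnW.
have := IH w dw u; rewrite e_sym => /(_ uw dxw).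
by rewrite du => /(_ ltac:(lia)); lia.
Qed.

(** If both eccentricities were [D = diam e], attained at [x] and [y], then [v] would be closer to
    [x] and [u] closer to [y]. By [gdist_across], [D + (D - 1) <= d(x, y) <= D], which contradicts
    [1 < D]. *)
Lemma ecc_edge_lt u v :
  e u v -> 1 < diam e -> ecc e u = diam e -> ecc e v < diam e.
Proof.
move=> uv D2 eu; rewrite ltn_neqAle ecc_le_diam andbT; apply/eqP => ev.
have [x dux] := ecc_attained e u; have [y dvy] := ecc_attained e v.
have dxu := gdist_sym conn e_sym x u; have dyv := gdist_sym conn e_sym y v.
have lexv : gdist e x v <= diam e := leq_trans (gdist_le_ecc _ _ _) (ecc_le_diam _ _).
have leyu : gdist e y u <= diam e := leq_trans (gdist_le_ecc _ _ _) (ecc_le_diam _ _).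
have lexy : gdist e x y <= diam e := leq_trans (gdist_le_ecc _ _ _) (ecc_le_diam _ _).
have nx := gdist_edge_neq (r := x) uv; have ny := gdist_edge_neq (r := y) uv.
have := @gdist_across x y u v uv; have := gdist_step conn y uv.
by lia.
Qed.

Lemma ecc_edge_mul u v :
  e u v -> 1 < diam e -> ecc e u * ecc e v <= diam e * (diam e).-1.
Proof.
move=> uv D2; have lu := ecc_le_diam e u; have lv := ecc_le_diam e v.
have [eu|nu] := eqVneq (ecc e u) (diam e).
  have := ecc_edge_lt uv D2 eu.
  by move=> ltv; apply: leq_mul => //; lia.
by rewrite mulnC; apply: leq_mul => //; lia.
Qed.

Definition edge_count : nat :=
  \sum_(u : V) \sum_(v : V | enum_rank u < enum_rank v) e u v.

(** Each edge is charged to its endpoint farther from a root [r]. By [parent_unique] every vertex is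
    charged at most once, and [r] never. *)
Lemma edge_count_le : edge_count <= #|V|.-1.
Proof.
have [V0|/card_gt0P[r _]] := posnP #|V|.
  by rewrite /edge_count big1 // => u; have := card0_eq V0 u; rewrite inE.
pose G u v : nat := e u v && (gdist e r v <= gdist e r u).
apply: (@leq_trans (\sum_(u : V) \sum_(v : V | v != u) G u v)).
  rewrite -sum_pairs_sym; apply: leq_sum => u _; apply: leq_sum => v _.
  rewrite /G [e v u]e_sym; case: (e u v) => //=.
  by have := leq_total (gdist e r u) (gdist e r v); lia.
rewrite -(cardC1 r) -sum1_card [X in _ <= X]big_mkcond /=.
apply: leq_sum => u _.
apply: (@leq_trans #|[pred v | e u v && (gdist e r v <= gdist e r u)]|).
  rewrite -sum1_card big_mkcond [X in _ <= X]big_mkcond /=.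
  apply: leq_sum => v _; rewrite /G inE; by case: (_ != _); case: (_ && _).
rewrite inE; have [->|ur] := eqVneq u r; rewrite /=.
  rewrite leqn0; apply/pred0P => v /=; rewrite gdistxx leqn0.
  apply/negP => /andP[rv /eqP /(gdist_eq0 conn) rv'].
  by rewrite rv' e_irr in rv.
by apply/card_le1_eqP => a b /andP[ua da] /andP[ub db]; apply: (parent_unique ub ua db da).
Qed.

End Tree.

(** * Comparison of [E2] with the Wiener index, and the equality case *)

Section Comparison.

Set Implicit Arguments.
Unset Strict Implicit.

Variables (V : finType) (e : rel V).
Hypothesis tree : is_tree e.

Let e_sym : symmetric e. Proof. by case: tree => [[]]. Qed.
Let e_irr : irreflexive e. Proof. by case: tree => [[]]. Qed.
Let conn : connected_graph e. Proof. by case: tree. Qed.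

Lemma gdist_edge_ge2 u v : u != v -> 2 <= gdist e u v + e u v.
Proof.
move=> uv; case euv: (e u v) => /=.
  by case duv: (gdist e u v) => [|k]; [rewrite (gdist_eq0 conn duv) eqxx in uv | lia].
rewrite addn0 ltnNge; apply: contraFN euv => /(gdist_le1 conn).
exact.
Qed.

Lemma wiener_edge_countE :
  wiener e + edge_count e =
  \sum_(u : V) \sum_(v : V | enum_rank u < enum_rank v) (gdist e u v + e u v).
Proof.
rewrite /wiener /edge_count -big_split; apply: eq_bigr => u _.
by rewrite -big_split.
Qed.

Lemma wiener_edge_count_ge : #|V| * #|V|.-1 <= wiener e + edge_count e.
Proof.
rewrite wiener_edge_countE -sum_pairs_const.
apply: leq_sum => u _; apply: leq_sum => v /rank_lt_neq.
exact: gdist_edge_ge2.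
Qed.

Lemma E2_le_edge_count : 1 < diam e -> E2 e <= edge_count e * (diam e * (diam e).-1).
Proof.
move=> D2; rewrite /E2 /edge_count big_distrl /=; apply: leq_sum => u _.
rewrite big_distrl big_mkcondr /=; apply: leq_sum => v _.
by case: ifP => // uv; rewrite mul1n; apply: ecc_edge_mul.
Qed.

Lemma triangle_free u v w : e u v -> e v w -> ~~ e w u.
Proof.
move=> uv vw; case: tree => _ _ /(_ [:: u; v; w] isT).
apply: contraNN => wu; rewrite /ucycleb /= uv vw wu /= !inE !andbT.
by rewrite negb_or [u == w]eq_sym !(adjacent_neq tree).
Qed.

Lemma diam_attained : 0 < #|V| -> exists u v, gdist e u v = diam e.
Proof.
move=> V0; rewrite /diam; have [u ->] := bigop.eq_bigmax (ecc e) V0.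
by have [v dv] := ecc_attained e u; exists u, v.
Qed.

(** If both eccentricities were 1, any third vertex [w] would form a triangle with [u] and [v]. *)
Lemma ecc_edge_ge2 u v : 2 < #|V| -> e u v -> 2 <= ecc e u * ecc e v.
Proof.
move=> n3 uv; have vu : e v u by rewrite e_sym.
have ecc_gt0 x y : e x y -> 0 < ecc e x.
  move=> xy; apply: leq_trans (gdist_le_ecc e x y).
  by rewrite lt0n; apply: contraTneq xy => /(gdist_eq0 conn) ->; rewrite e_irr.
have [w] : exists w, w \notin [:: u; v].
  apply/existsP; rewrite -negb_forall; apply: contraL n3 => /forallP all_uv.
  rewrite -leqNgt; apply: leq_trans (card_size [:: u; v]).
  by apply/subset_leq_card/subsetP => x _; apply: all_uv.
rewrite !inE negb_or => /andP[wu wv].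
have eu := ecc_gt0 _ _ uv; have ev := ecc_gt0 _ _ vu.
rewrite leqNgt; apply/negP => lt2.
have adj x : ecc e x <= 1 -> w != x -> e x w.
  rewrite eq_sym => ex; apply: (gdist_le1 conn).
  exact: leq_trans (gdist_le_ecc e x w) ex.
have uw : e u w by apply: adj => //; nia.
have vw : e v w by apply: adj => //; nia.
by have := triangle_free uv vw; rewrite e_sym uw.
Qed.

Lemma diam_ge2 : 2 < #|V| -> 1 < diam e.
Proof.
move=> n3; have /card_gt0P[u _] : 0 < #|V| by lia.
have [x ux] : exists x, x != u.
  apply/existsP; rewrite -[[exists _, _]]negbK negb_exists; apply/negP => /forallP all_u.
  have : #|V| <= #|pred1 u|.
    by apply/subset_leq_card/subsetP => x _; have := all_u x; rewrite negbK.
  by rewrite card1; lia.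
have [y uy] : exists y, e u y.
  have /connectP[[|y p] /= pp lp] := conn u x; first by rewrite lp eqxx in ux.
  by exists y; case/andP: pp.
have := ecc_edge_ge2 n3 uy; have := ecc_le_diam e u; have := ecc_le_diam e y.
have [//|D1] := ltnP 1 (diam e).
by nia.
Qed.

Hypothesis n3 : 2 < #|V|.
Hypothesis small_diam : diam e * (diam e).-1 < #|V|.

Lemma E2_le_wiener : E2 e <= wiener e.
Proof.
have := E2_le_edge_count (diam_ge2 n3); have := wiener_edge_count_ge.
have := edge_count_le tree.
(* With [m] edges and [n] vertices, [E2 + m <= m * n <= n * (n - 1) <= W + m]. *)
by nia.
Qed.

Lemma E2_eq_wiener_card : E2 e = wiener e -> #|V| = 3.
Proof.
move=> eqEW; have D2 := diam_ge2 n3.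
have leE := E2_le_edge_count D2; have leW := wiener_edge_count_ge.
have lem := edge_count_le tree.
(* Equality makes the whole chain [E2 + m <= m * D * (D - 1) + m <= m * n <= n * (n - 1) <= W + m]
   tight. *)
have eqW : wiener e + edge_count e <= #|V| * #|V|.-1 by nia.
have Dcard : #|V|.-1 <= diam e * (diam e).-1 by nia.
have dist2 u v : gdist e u v <= 2.
  have eq_lt x y : enum_rank x < enum_rank y -> 2 = gdist e x y + e x y.
    apply: (eq_sum_pairs_leq (F := fun _ _ => 2) (G := fun x y => gdist e x y + e x y)).
      exact: gdist_edge_ge2.
    by rewrite -wiener_edge_countE sum_pairs_const.
  case: (ltngtP (enum_rank u) (enum_rank v)) => [/eq_lt|/eq_lt|/val_inj/enum_rank_inj->].
  - by lia.
  - by rewrite (gdist_sym conn e_sym); lia.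
  - by rewrite gdistxx.
have [|u [v duv]] := diam_attained; first by lia.
(* Now [D <= 2], so [Dcard] gives [n - 1 <= 2]. *)
by have := dist2 u v; rewrite duv; nia.
Qed.

Lemma path3_iso : #|V| = 3 -> graph_iso e (path_graph 3).
Proof.
move=> V3; have [|x [y dxy]] := diam_attained; first by lia.
(* [small_diam] reads [D * (D - 1) < 3], which excludes [D >= 3]. *)
have D2 : gdist e x y = 2 by have := diam_ge2 n3; nia.
have [c yc dc] := gdist_parent conn e_sym D2.
have xy : x != y by apply/eqP => exy; rewrite exy gdistxx in D2.
have xc : e x c.
  by apply: (gdist_le1 conn); rewrite ?dc //; apply/eqP => exc; rewrite exc gdistxx in dc.
have nxy : e x y = false.
  by apply/negP => /gdist_edge; rewrite D2.
pose g (i : 'I_3) := nth x [:: x; c; y] i.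
have g_inj : injective g.
  move=> i j /eqP; rewrite nth_uniq //=; first by move=> /eqP/val_inj.
  by rewrite !inE !negb_or xy (adjacent_neq tree) // eq_sym (adjacent_neq tree).
have [f gf fg] : bijective g by apply: inj_card_bij => //; rewrite V3 card_ord.
exists f; first by exists g.
move=> u v; rewrite -{1}(fg u) -{1}(fg v) /path_graph /g.
by case: (f u) (f v) => [[|[|[|?]]] //= ?] [[|[|[|?]]] //= ?];
  rewrite ?e_irr ?xc ?yc // e_sym ?nxy ?xc ?yc.
Qed.

Lemma path3_edge_count : graph_iso e (path_graph 3) -> #|V| = 3 /\ edge_count e = 2.
Proof.
case=> f f_bij f_iso.
have V3 : #|V| = 3 by rewrite (bij_eq_card f_bij) card_ord.
split=> //.
(* Ordered pairs count each edge twice, and their sum can be transported along [f] and computed in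
   [path_graph 3]. *)
have : \sum_(u : V) \sum_(v : V | v != u) e u v = 4.
  transitivity (\sum_(u : V) \sum_(v : V) path_graph 3 (f u) (f v)).
    apply: eq_bigr => u _; rewrite big_mkcond; apply: eq_bigr => v _ /=.
    by rewrite -f_iso; case: eqVneq => //= ->; rewrite e_irr.
  have [g fg gf] := f_bij.
  have g_bij : bijective g by exists f.
  rewrite (reindex g) /=; last exact: onW_bij.
  under eq_bigr => i _.
    rewrite (reindex g) /=; last exact: onW_bij.
    under eq_bigr do rewrite !gf.
    over.
  by rewrite !big_ord_recl !big_ord0.
rewrite -sum_pairs_sym /edge_count.
under eq_bigr => u _ do under eq_bigr => v _ do rewrite (e_sym v u) addnn -muln2.
under eq_bigr do rewrite -big_distrl /=.
by rewrite -big_distrl /=; lia.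
Qed.

(** Only [W <= E2] is missing: [W + 2 <= 6], as each of the 3 pairs contributes at most 2, while
    each of the 2 edges contributes at least 2 to [E2]. *)
Lemma E2_eq_wiener_path3 : graph_iso e (path_graph 3) -> E2 e = wiener e.
Proof.
move=> /path3_edge_count[V3 m2].
have D2 : diam e = 2 by have := diam_ge2 n3; nia.
apply/eqP; rewrite eqn_leq E2_le_wiener /=.
have leW : wiener e + edge_count e <= 6.
  apply: (@leq_trans (#|V| * #|V|.-1)); last by rewrite V3.
  rewrite wiener_edge_countE -sum_pairs_const.
  apply: leq_sum => u _; apply: leq_sum => v _.
  case euv: (e u v); first by rewrite addn1 ltnS gdist_edge.
  by rewrite addn0 -D2; apply: leq_trans (gdist_le_ecc _ _ _) (ecc_le_diam _ _).
have geE : edge_count e * 2 <= E2 e.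
  rewrite /E2 /edge_count big_distrl /=; apply: leq_sum => u _.
  rewrite big_distrl [X in _ <= X]big_mkcondr /=; apply: leq_sum => v _.
  by case: ifP => // uv; rewrite mul1n; apply: ecc_edge_ge2.
by lia.
Qed.

End Comparison.

(** Squaring [2 * D - 1 <= sqrt (4 * n - 3)] gives [4 * D * (D - 1) + 1 <= 4 * n - 3]. *)
Lemma diam_bound_nat (R : rcfType) (D n : nat) : 0 < D -> 0 < n ->
  (D%:R <= (1 + Num.sqrt (4 * n%:R - 3)) / 2 :> R)%R -> D * D.-1 < n.
Proof.
case: D => // D _ n0 leD.
have s_ge0 : (0 <= 4 * n%:R - 3 :> R)%R.
  by have : (1 <= n%:R :> R)%R; [rewrite ler1n | lra].
(* [D] now stands for the predecessor of the original value, so [2 * D - 1] has become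
   [2 * D + 1]. *)
have le_sqrt : (2 * D%:R + 1 <= Num.sqrt (4 * n%:R - 3) :> R)%R.
  by move: leD; rewrite -natr1; lra.
have D0 : (0 <= D%:R :> R)%R by [].
have : ((2 * D%:R + 1) ^+ 2 <= 4 * n%:R - 3 :> R)%R.
  rewrite -[leRHS]sqr_sqrtr // lerXn2r // nnegrE ?sqrtr_ge0 //; lra.
move=> le_sq; rewrite -(ler_nat R) -natr1 natrM -natr1 /=.
by move: le_sq; rewrite expr2; lra.
Qed.

Theorem theorem3p1 (R : rcfType) (V : finType) (e : rel V)
    (hT : is_tree e) (hn : 3 <= #|V|)
    (hdiam : ((diam e)%:R <= (1 + Num.sqrt (4 * #|V|%:R - 3)) / 2 :> R)%R) :
  E2 e <= wiener e /\ (E2 e = wiener e <-> graph_iso e (path_graph 3)).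
Proof.
have small_diam : diam e * (diam e).-1 < #|V|.
  apply: diam_bound_nat hdiam; last exact: ltnW (ltnW hn).
  exact: ltnW (diam_ge2 hT hn).
split; first exact: E2_le_wiener.
split; last exact: E2_eq_wiener_path3.
by move=> /(E2_eq_wiener_card hT hn small_diam); apply: path3_iso.
Qed.
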